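(* Let $A_1\in\mathcal{S}_{n_1}^{+}$ and $A_2\in\mathcal{S}_{n_2}^{+}$. Then $$\operatorname{rk}(A_1)\operatorname{rk}(A_2)\le \operatorname{st}_{+}(A_1\otimes A_2)\le \operatorname{st}_{+}(A_1)\operatorname{st}_{+}(A_2).$$ Moreover, if $n_1,n_2\le 3$, then $$\operatorname{st}_{+}(A_1\otimes A_2)=\operatorname{st}_{+}(A_1)\operatorname{st}_{+}(A_2).$$
   Context: Here $\mathbb{R}_{+}^{m\times n}$ is the set of $m\times n$ real matrices with nonnegative entries and $\mathcal{S}_n^{+}$ is the set of symmetric $n\times n$ matrices with nonnegative entries. $\operatorname{rk}$ is the usual rank and $\otimes$ is the Kronecker product. For $A\in\mathcal{S}_n^{+}$, an SN-Trifactorization of $A$ is a factorization $A=BCB^{T}$ with $B\in\mathbb{R}_{+}^{n\times k}$ and $C\in\mathcal{S}_k^{+}$; the SNT-rank $\operatorname{st}_{+}(A)$ is the smallest integer $k$ for which such a factorization exists, with the convention $\operatorname{st}_{+}(0)=0$. *)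

(* Defs.v *)
From mathcomp Require Import all_boot all_order all_algebra.
From mathcomp Require Import boolp reals.
From mathcomp Require Import sesquilinear mxtens.

Set Implicit Arguments.
Unset Strict Implicit.
Unset Printing Implicit Defensive.

Import Order.TTheory GRing.Theory Num.Theory.
Local Open Scope ring_scope.

Definition nonnegmx (R : realType) m n (A : 'M[R]_(m, n)) : bool :=
  A \is a mxOver Num.nneg.

Definition symnonneg (R : realType) n (A : 'M[R]_n) : bool :=
  (A \is symmetricmx) && nonnegmx A.

Definition SN_trifactorization (R : realType) n k (A : 'M[R]_n)
    (B : 'M[R]_(n, k)) (C : 'M[R]_k) : Prop :=
  [/\ nonnegmx B, symnonneg C & A = B *m C *m B^T].

Definition has_SN_trifactorization (R : realType) n (A : 'M[R]_n) (k : nat) :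
    Prop :=
  exists (B : 'M[R]_(n, k)) (C : 'M[R]_k), SN_trifactorization A B C.

(* The inner size k = 0 is allowed, and it occurs exactly for A = 0: this is
   the convention that the SNT-rank of 0 is 0 (st_rank0 below).
   The value 0 in the second branch is never reached on the domain of the
   SNT-rank: a symmetric nonnegative A has the SN-Trifactorization
   1%:M *m A *m 1%:M^T (see st_rankP). *)
Definition st_rank (R : realType) n (A : 'M[R]_n) : nat :=
  if pselect (exists k, `[< has_SN_trifactorization A k >]) is left exA
  then ex_minn exA else 0%N.

Lemma symnonnegP (R : realType) n (A : 'M[R]_n) :
  reflect (A^T = A /\ forall i j, 0 <= A i j) (symnonneg A).
Proof.
apply: (iffP andP) => -[].
  move=> /is_hermitianmxP; rewrite expr0 scale1r map_mx_id // => AT Age.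
  split=> [//|i j].
  by move/mxOverP: Age => /(_ i j).
move=> AT Age; split; last by apply/mxOverP => i j; exact: Age.
by apply/is_hermitianmxP; rewrite expr0 scale1r map_mx_id.
Qed.

Lemma st_rankP (R : realType) n (A : 'M[R]_n) : symnonneg A ->
  has_SN_trifactorization A (st_rank A) /\
  (forall k, has_SN_trifactorization A k -> (st_rank A <= k)%N).
Proof.
move=> symA; rewrite /st_rank; case: pselect => [exA|[]].
  case: ex_minnP => k /asboolP kA kmin; split=> // l lA.
  by apply: kmin; apply/asboolP.
exists n; apply/asboolP; exists 1%:M, A; split=> //.
  by apply/mxOverP => i j; rewrite mxE qualifE /= ler0n.
by rewrite trmx1 mulmx1 mul1mx.
Qed.

Lemma st_rank0 (R : realType) n : st_rank (0 : 'M[R]_n) = 0%N.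
Proof.
have sym0 k : symnonneg (0 : 'M[R]_k).
  by apply/symnonnegP; rewrite trmx0; split=> // i j; rewrite mxE.
apply/eqP; rewrite -leqn0; apply: (st_rankP (sym0 n)).2.
exists 0, 0; split; first by apply/mxOverP => i j; rewrite mxE qualifE /=.
  exact: sym0.
by rewrite !mul0mx.
Qed.

Lemma symnonneg_tens (R : realType) m n (A : 'M[R]_m) (B : 'M[R]_n) :
  symnonneg A -> symnonneg B -> symnonneg (tensmx A B).
Proof.
move=> /symnonnegP[AT Age] /symnonnegP[BT Bge]; apply/symnonnegP; split.
  by rewrite trmx_tens AT BT.
by move=> i j; rewrite mxE mulr_ge0.
Qed.

(* Main.v *)
(** For a symmetric nonnegative A of rank at most 2 the SNT-rank equals the
    rank: the rows of A lie in a pointed cone of dimension \rank A <= 2, which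
    is generated by \rank A of them (its extreme rays), so A = W *m rowsub f A
    with W nonnegative; transposing and substituting, A = W *m A' *m W^T where
    A' is the principal submatrix of A on the chosen indices. A 3 x 3 matrix
    has rank at most 2 or full rank, where the trivial factorization is
    optimal. Hence for n1, n2 <= 3 the two general bounds coincide, the rank
    being multiplicative under the Kronecker product. *)
Require Import Defs.
From mathcomp Require Import all_boot all_order all_algebra.
From mathcomp Require Import reals mxtens.
From mathcomp Require Import ring.

Set Implicit Arguments.
Unset Strict Implicit.
Unset Printing Implicit Defensive.

Import Order.TTheory GRing.Theory Num.Theory.
Local Open Scope ring_scope.

(** * Rank of a Kronecker product *)

Lemma tensmx1 (R : comPzRingType) m n :
  tensmx (1%:M : 'M[R]_m) (1%:M : 'M[R]_n) = 1%:M.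
Proof.
apply/matrixP => i j; case: (mxtens_indexP i) => a b.
case: (mxtens_indexP j) => c d.
rewrite tensmxE !mxE (inj_eq (can_inj (@mxtens_indexK m n))) xpair_eqE.
by rewrite -natrM mulnb.
Qed.

(** One-sided inverses of the two full-rank factors of [A] compress it to an identity. Such
    compressions multiply under [tensmx], which gives the lower bound on the rank in
    [mxrank_tens]. *)
Lemma mxrank_unit_factors (F : fieldType) m n (A : 'M[F]_(m, n)) :
  exists (L : 'M[F]_(\rank A, m)) (P : 'M[F]_(n, \rank A)), L *m A *m P = 1%:M.
Proof.
have [L LK] := row_fullP (col_base_full A).
have [P PK] := row_freeP (row_base_free A).
exists L, P; rewrite -[X in L *m X]mulmx_base (mulmxA L (col_base A)) LK.
by rewrite mul1mx PK.
Qed.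

Lemma mxrank_tens (F : fieldType) m n p q (A : 'M[F]_(m, n)) (B : 'M[F]_(p, q)) :
  \rank (tensmx A B) = (\rank A * \rank B)%N.
Proof.
apply/eqP; rewrite eqn_leq; apply/andP; split.
  rewrite -{1}(mulmx_base A) -{1}(mulmx_base B) -tensmx_mul.
  exact: mulmx_max_rank.
have [L1 [R1 A1]] := mxrank_unit_factors A.
have [L2 [R2 B1]] := mxrank_unit_factors B.
have rank1 : tensmx L1 L2 *m tensmx A B *m tensmx R1 R2 = 1%:M.
  by rewrite !tensmx_mul A1 B1 tensmx1.
rewrite -[leqLHS](mxrank1 F) -rank1.
by apply: leq_trans (mxrankM_maxl _ _) (mxrankM_maxr _ _).
Qed.

(** * Constructions of trifactorizations and the rank bound *)

Lemma nonnegmx_tens (R : realType) m n p q (A : 'M[R]_(m, n)) (B : 'M[R]_(p, q)) :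
  nonnegmx A -> nonnegmx B -> nonnegmx (tensmx A B).
Proof.
move=> /mxOverP A_ge0 /mxOverP B_ge0; apply/mxOverP => i j.
by rewrite mxE rpredM.
Qed.

Lemma has_SN_trifactorization_tens (R : realType) m n (A : 'M[R]_m)
    (B : 'M[R]_n) k l :
  has_SN_trifactorization A k -> has_SN_trifactorization B l ->
  has_SN_trifactorization (tensmx A B) (k * l).
Proof.
move=> [U [C [U_ge0 symC ->]]] [V [D [V_ge0 symD ->]]].
exists (tensmx U V), (tensmx C D); split.
- exact: nonnegmx_tens.
- exact: symnonneg_tens.
- by rewrite trmx_tens !tensmx_mul.
Qed.

Lemma has_SN_trifactorization_rank (R : realType) n (A : 'M[R]_n) k :
  has_SN_trifactorization A k -> (\rank A <= k)%N.
Proof. by move=> [B [C [_ _ ->]]]; rewrite -mulmxA mulmx_max_rank. Qed.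

Lemma has_SN_trifactorization_size (R : realType) n (A : 'M[R]_n) :
  symnonneg A -> has_SN_trifactorization A n.
Proof.
move=> symA; exists 1%:M, A; split=> //; last by rewrite trmx1 mulmx1 mul1mx.
by apply/mxOverP => i j; rewrite mxE qualifE /= ler0n.
Qed.

Lemma has_SN_trifactorization_rowsub (R : realType) n (A : 'M[R]_n) k
    (f : 'I_k -> 'I_n) (W : 'M[R]_(n, k)) :
  symnonneg A -> nonnegmx W -> A = W *m rowsub f A ->
  has_SN_trifactorization A k.
Proof.
move=> /symnonnegP[AT A_ge0] W_ge0 defA.
exists W, (mxsub f f A); split=> //.
  apply/symnonnegP; split=> [|i j]; last by rewrite mxE.
  by rewrite trmx_mxsub AT.
have defAT : A = colsub f A *m W^T.
  by rewrite -{1}AT {1}defA trmx_mul trmx_mxsub AT.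
by rewrite mxsubrc -mulmxA mul_rowsub_mx -defAT.
Qed.

(** * Nonnegative factorizations through selected rows, in rank one and two *)

Lemma mxrank_le1 (F : fieldType) m n (A : 'M[F]_(m, n)) (s : 'I_m -> F) i :
  s i != 0 -> (forall k j, A k j * s i = s k * A i j) -> (\rank A <= 1)%N.
Proof.
move=> si_neq0 As; have -> : A = (\col_k (s k / s i)) *m row i A.
  apply/matrixP => k j; rewrite !mxE big_ord1 !mxE.
  by rewrite mulrAC -As mulfK.
exact: mulmx_max_rank.
Qed.

Lemma nonnegmx_row_sum_eq0 (R : realType) m n (A : 'M[R]_(m, n)) k :
  nonnegmx A -> \sum_j A k j = 0 -> forall j, A k j = 0.
Proof.
move=> /mxOverP A_ge0 /eqP; rewrite psumr_eq0 => [/allP sk0 j|j _].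
  by apply/eqP/sk0; rewrite mem_index_enum.
exact: A_ge0.
Qed.

Lemma nonnegmx_row_sum_gt0 (R : realType) m n (A : 'M[R]_(m, n)) :
  nonnegmx A -> A != 0 -> exists i, 0 < \sum_j A i j.
Proof.
move=> A_ge0 A_neq0; apply/existsP; apply: contraNT A_neq0 => /existsPn s_le0.
apply/eqP/matrixP => k j; rewrite mxE; apply: nonnegmx_row_sum_eq0 => //.
apply: le_anti; rewrite leNgt sumr_ge0 ?andbT.
  exact: s_le0.
by move=> l _; move/mxOverP: A_ge0; apply.
Qed.

Lemma nonneg_rowsub_factor_rank1 (R : realType) m n (A : 'M[R]_(m, n)) :
  nonnegmx A -> \rank A = 1%N ->
  exists (f : 'I_1 -> 'I_m) (W : 'M[R]_(m, 1)),
    nonnegmx W /\ A = W *m rowsub f A.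
Proof.
move=> A_ge0 rA.
have [i si_gt0] : exists i, 0 < \sum_j A i j.
  by apply: nonnegmx_row_sum_gt0; rewrite // -mxrank_eq0 rA.
have [u [v defA]] : exists (u : 'cV[R]_m) (v : 'rV[R]_n), A = u *m v.
  move: (col_base A) (row_base A) (mulmx_base A); rewrite rA => u v <-.
  by exists u, v.
have AE k j : A k j = u k 0 * v 0 j by rewrite defA mxE big_ord1.
(* The rows are proportional, so ratios of row sums recover the coefficients. They are visibly
   nonnegative, while the entries of [u] may have any sign. *)
exists (fun=> i), (\col_k ((\sum_j A k j) / \sum_j A i j)); split.
  apply/mxOverP => k j; rewrite mxE nnegrE divr_ge0 ?(ltW si_gt0) //.
  by apply: sumr_ge0 => l _; move/mxOverP: A_ge0; apply.
apply/matrixP => k j; rewrite !mxE big_ord1 !mxE.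
apply: (mulIf (lt0r_neq0 si_gt0)); rewrite mulrAC divfK ?lt0r_neq0 //.
rewrite mulr_sumr mulr_suml; apply: eq_bigr => l _; rewrite !AE; ring.
Qed.

(* Row k has coordinates (x k, y k) in a basis V of the row space. Its sum s k
   is the pairing with (a, b), and t k is the pairing with the orthogonal vector
   (- b, a), so the extreme rays of the cone generated by the rows are those
   minimizing and maximizing the slope t / s. *)
Lemma nonneg_rowsub_factor_rank2 (R : realType) m n (A : 'M[R]_(m, n)) :
  nonnegmx A -> \rank A = 2%N ->
  exists (f : 'I_2 -> 'I_m) (W : 'M[R]_(m, 2)),
    nonnegmx W /\ A = W *m rowsub f A.
Proof.
move=> A_ge0 rA.
have [i0 s0_gt0] : exists i, 0 < \sum_j A i j.
  by apply: nonnegmx_row_sum_gt0; rewrite // -mxrank_eq0 rA.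
have [U [V defA]] : exists (U : 'M[R]_(m, 2)) (V : 'M[R]_(2, n)), A = U *m V.
  move: (col_base A) (row_base A) (mulmx_base A); rewrite rA => U V <-.
  by exists U, V.
pose x k := U k 0; pose y k := U k 1.
have AE k j : A k j = x k * V 0 j + y k * V 1 j.
  by rewrite defA mxE big_ord_recl big_ord1; congr (_ * _ + _ * V _ _);
     [congr (U _ _)|]; apply: val_inj.
pose a := \sum_j V 0 j; pose b := \sum_j V 1 j.
pose s k := \sum_j A k j; pose t k := a * y k - b * x k.
have sE k : s k = x k * a + y k * b.
  by rewrite /s !mulr_sumr -big_split; apply: eq_bigr => j _; rewrite AE.
have s_ge0 k : 0 <= s k.
  by apply: sumr_ge0 => l _; move/mxOverP: A_ge0; apply.
have As0 k j : s k = 0 -> A k j = 0.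
  by move=> sk0; apply: (nonnegmx_row_sum_eq0 A_ge0).
pose D k l := s k * t l - t k * s l.
have D_anti k l : D k l = - D l k by rewrite opprB /D mulrC [t k * _]mulrC.
(* Cramer's rule in the plane: once [D i j] is nonzero, this expresses row [k] through rows [i] and
   [j]. *)
have cramer i j k l : D i j * A k l = D k j * A i l + D i k * A j l.
  by rewrite /D /t !sE !AE; ring.
(* The change of coordinates from [(x, y)] to [(s, t)] has determinant [a ^+ 2 + b ^+ 2]. *)
have DE k l : D k l = (a ^+ 2 + b ^+ 2) * (x k * y l - y k * x l).
  by rewrite /D /t !sE; ring.
have slopeE k l : 0 < s k -> 0 < s l -> (0 <= D k l) = (t k / s k <= t l / s l).
  move=> sk_gt0 sl_gt0.
  by rewrite subr_ge0 ler_pdivrMr // mulrAC ler_pdivlMr // [s k * _]mulrC.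
case: (@arg_minP _ _ _ i0 (fun k => 0 < s k) (fun k => t k / s k) s0_gt0)
  => i si_gt0 i_min.
case: (@arg_maxP _ _ _ i0 (fun k => 0 < s k) (fun k => t k / s k) s0_gt0)
  => j sj_gt0 j_max.
have Dik_ge0 k : 0 < s k -> 0 <= D i k by move=> sk_gt0; rewrite slopeE ?i_min.
have Dkj_ge0 k : 0 < s k -> 0 <= D k j.
  by move=> sk_gt0; rewrite slopeE //; apply: j_max.
(* Otherwise the extreme slopes coincide, so all nonzero rows have the same slope and are
   proportional to row [i], contradicting rank 2. *)
have Dij_gt0 : 0 < D i j.
  rewrite lt_def Dik_ge0 // andbT; apply/negP => /eqP Dij0.
  suff : (\rank A <= 1)%N by rewrite rA.
  apply: (@mxrank_le1 _ _ _ _ s i); rewrite ?lt0r_neq0 // => k l.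
  have [sk0|sk_neq0] := eqVneq (s k) 0; first by rewrite sk0 As0 ?mul0r.
  have sk_gt0 : 0 < s k by rewrite lt_def sk_neq0 s_ge0.
  have Dki_ge0 : 0 <= D k i.
    rewrite slopeE //; apply: le_trans (j_max k sk_gt0) _.
    by rewrite -slopeE // D_anti Dij0 oppr0.
  have /eqP : D i k = 0.
    by apply: le_anti; rewrite Dik_ge0 // -oppr_ge0 -D_anti Dki_ge0.
  rewrite DE mulf_eq0 => /orP[|/eqP det0].
    rewrite paddr_eq0 ?sqr_ge0 // !sqrf_eq0 => /andP[/eqP a0 /eqP b0].
    by move: si_gt0; rewrite sE a0 b0 !mulr0 addr0 ltxx.
  apply/eqP; rewrite -subr_eq0.
  (* Multiplicativity of the determinant: the minor formed by the row sums and column [l] contains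
     the coordinate determinant of rows [i] and [k] as a factor. *)
  have -> : A k l * s i - s k * A i l =
      (x i * y k - y i * x k) * (a * V 1 l - b * V 0 l).
    by rewrite !sE !AE; ring.
  by rewrite det0 mul0r.
(* The weights are the coefficients from [cramer]. Their signs are known only when [s k] is
   positive; a row with [s k = 0] vanishes and gets weight 0. *)
exists (fun p => if p == 0 then i else j).
exists (\matrix_(k, p)
  (if s k == 0 then 0 else (if p == 0 then D k j else D i k) / D i j)).
split.
  apply/mxOverP => k p; rewrite mxE nnegrE; case: eqP => // /eqP sk0.
  have sk_gt0 : 0 < s k by rewrite lt_def sk0 s_ge0.
  by case: ifP => _; rewrite divr_ge0 ?(ltW Dij_gt0) ?Dik_ge0 ?Dkj_ge0.
apply/matrixP => k l; rewrite mxE big_ord_recl big_ord1 !mxE /=.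
case: eqP => [sk0|_]; first by rewrite !mul0r addr0 As0.
apply: (mulfI (lt0r_neq0 Dij_gt0)); rewrite cramer.
by field; rewrite lt0r_neq0.
Qed.

(** * Equality of SNT-rank and rank in small cases, and the theorem *)

Lemma st_rank_low_rank (R : realType) n (A : 'M[R]_n) :
  symnonneg A -> (\rank A <= 2)%N -> st_rank A = \rank A.
Proof.
move=> symA rA_le2; have [stA st_min] := st_rankP symA.
apply/eqP; rewrite eqn_leq has_SN_trifactorization_rank // andbT.
have A_ge0 : nonnegmx A by case/andP: symA.
case rA: (\rank A) rA_le2 => [|[|[|//]]] _.
- by move/eqP: rA; rewrite mxrank_eq0 => /eqP ->; rewrite st_rank0.
- have [f [W [W_ge0 defA]]] := nonneg_rowsub_factor_rank1 A_ge0 rA.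
  exact/st_min/(has_SN_trifactorization_rowsub symA W_ge0 defA).
- have [f [W [W_ge0 defA]]] := nonneg_rowsub_factor_rank2 A_ge0 rA.
  exact/st_min/(has_SN_trifactorization_rowsub symA W_ge0 defA).
Qed.

Lemma st_rank_le3 (R : realType) n (A : 'M[R]_n) :
  symnonneg A -> (n <= 3)%N -> st_rank A = \rank A.
Proof.
move=> symA n_le3; have [rA_le2|rA_gt2] := leqP (\rank A) 2.
  exact: st_rank_low_rank.
have [stA st_min] := st_rankP symA.
apply/eqP; rewrite eqn_leq has_SN_trifactorization_rank // andbT.
apply: (leq_trans _ (leq_trans n_le3 rA_gt2)).
by apply: st_min; apply: has_SN_trifactorization_size.
Qed.

Theorem theorem1p2 (R : realType) (n1 n2 : nat)
    (A1 : 'M[R]_n1) (A2 : 'M[R]_n2)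
    (hA1 : symnonneg A1) (hA2 : symnonneg A2) :
  (\rank A1 * \rank A2 <= st_rank (tensmx A1 A2)
     <= st_rank A1 * st_rank A2)%N /\
  ((n1 <= 3)%N -> (n2 <= 3)%N ->
   st_rank (tensmx A1 A2) = (st_rank A1 * st_rank A2)%N).
Proof.
have [st1 _] := st_rankP hA1; have [st2 _] := st_rankP hA2.
have [st12 st12_min] := st_rankP (symnonneg_tens hA1 hA2).
have lower : (\rank A1 * \rank A2 <= st_rank (tensmx A1 A2))%N.
  by rewrite -mxrank_tens has_SN_trifactorization_rank.
have upper : (st_rank (tensmx A1 A2) <= st_rank A1 * st_rank A2)%N.
  by apply: st12_min; apply: has_SN_trifactorization_tens.
split=> [|n1_le3 n2_le3]; first by rewrite lower.
by apply/eqP; rewrite eqn_leq upper (st_rank_le3 hA1) ?(st_rank_le3 hA2).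
Qed.
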